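(* Let $n,\alpha$ be positive integers and $\varepsilon\in(0,1)$. Suppose a dataset $S$ over the universe $[n]$ is distributed across $\alpha$ players with the promise that there are at most $C\le F_0(S)$ pairwise collisions. Then there exists a protocol that uses total communication \[\tilde{O}\left(\alpha\log n+\max\left(\frac{1}{F_0(S)},\varepsilon^2\right)\cdot\frac{C}{\varepsilon^2}\log n\right)\] bits and, with probability at least $\frac{2}{3}$, outputs a $(1+\varepsilon)$-approximation to $F_0(S)$.
   Context: Distributed distinct element estimation (coordinator model): there are $\alpha$ servers (players), one of which acts as coordinator; server $a$ holds a vector $v^{(a)}\in\{0,1\}^n$, and $S$ denotes the union (multiset) of all items held by the servers. All communication goes between the coordinator and the other servers; the communication cost is the total number of bits exchanged in the worst case. $F_0(S)$ is the number of $j\in[n]$ with $v^{(a)}_j=1$ for some $a$. The number of pairwise collisions is the number of triples $(a,b,i)$ with $1\le a<b\le\alpha$, $i\in[n]$ and $v^{(a)}_i=v^{(b)}_i=1$. A $(1+\varepsilon)$-approximation to $F$ is a value $\hat F$ with $(1-\varepsilon)F\le\hat F\le(1+\varepsilon)F$. $\tilde{O}$ hides polylogarithmic factors. *)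

(* Defs.v *)
From HB Require Import structures.
From mathcomp Require Import all_boot all_order all_algebra.
From mathcomp Require Import reals.
Set Implicit Arguments. Unset Strict Implicit. Unset Printing Implicit Defensive.
Import Order.TTheory GRing.Theory Num.Theory.
Local Open Scope ring_scope.

Definition vec (n : nat) := {ffun 'I_n -> bool}.
Definition dataset (n alpha : nat) := {ffun 'I_alpha -> vec n}.

Definition F0 (n alpha : nat) (V : dataset n alpha) : nat :=
  #|[set j : 'I_n | [exists a : 'I_alpha, V a j]]|.

Definition collisions (n alpha : nat) (V : dataset n alpha) : nat :=
  #|[set x : 'I_alpha * 'I_alpha * 'I_n |
       [&& (x.1.1 < x.1.2)%N, V x.1.1 x.2 & V x.1.2 x.2]]|.

Definition approx (R : numDomainType) (eps F Fh : R) : Prop :=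
  (1 - eps) * F <= Fh /\ Fh <= (1 + eps) * F.

(* A transcript: sequence of (channel a, direction, bit); direction true means
   "server a -> coordinator", false means "coordinator -> server a". *)
Definition trans (alpha : nat) := seq ('I_alpha * bool * bool).

Definition proj (alpha : nat) (a : 'I_alpha) (t : trans alpha) : seq (bool * bool) :=
  [seq (x.1.2, x.2) | x <- t & x.1.1 == a].

Definition seed (sb : nat) := {ffun 'I_sb -> bool}.

Record protocol (R : Type) (n alpha : nat) := Protocol {
  coord : 'I_alpha;
  seedbits : nat;
  rounds : nat;            (* a priori bound on the number of bits sent *)
  (* The coordinator (who sees the whole transcript) schedules the next bit:
     None = halt, Some (a, true) = server a sends a bit to the coordinator,
     Some (a, false) = coordinator sends a bit to server a. *)
  sched : vec n -> seed seedbits -> trans alpha -> option ('I_alpha * bool);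
  (* bit sent by server a: depends only on its input, its randomness and its
     own channel's history *)
  pmsg : 'I_alpha -> vec n -> seed seedbits -> seq (bool * bool) -> bool;
  cmsg : vec n -> seed seedbits -> trans alpha -> bool;
  out : vec n -> seed seedbits -> trans alpha -> R }.
Arguments coord {R n alpha} p.
Arguments seedbits {R n alpha} p.
Arguments rounds {R n alpha} p.
Arguments sched {R n alpha} p _ _ _.
Arguments pmsg {R n alpha} p _ _ _ _.
Arguments cmsg {R n alpha} p _ _ _.
Arguments out {R n alpha} p _ _ _.

Section Run.
Variables (R : Type) (n alpha : nat) (P : protocol R n alpha).
Definition seeds := {ffun 'I_alpha -> seed (seedbits P)}.

Definition step (V : dataset n alpha) (r : seeds) (t : trans alpha)
  : option (trans alpha) :=
  let c := coord P in
  match sched P (V c) (r c) t with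
  | None => None
  | Some (a, up) =>
      let b := if up then pmsg P a (V a) (r a) (proj a t)
               else cmsg P (V c) (r c) t in
      Some (rcons t (a, up, b))
  end.

Fixpoint run (V : dataset n alpha) (r : seeds) (k : nat) (t : trans alpha) :=
  match k with
  | 0 => t
  | k'.+1 => match step V r t with None => t | Some t' => run V r k' t' end
  end.

Definition transcript (V : dataset n alpha) (r : seeds) : trans alpha :=
  run V r (rounds P) [::].

Definition cost (V : dataset n alpha) : nat :=
  \max_(r : seeds) size (transcript V r).

Definition output (V : dataset n alpha) (r : seeds) : R :=
  let c := coord P in out P (V c) (r c) (transcript V r).
End Run.
Arguments seeds {R n alpha} P.
Arguments step {R n alpha} P V r t.
Arguments run {R n alpha} P V r k t.
Arguments transcript {R n alpha} P V r.
Arguments cost {R n alpha} P V.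
Arguments output {R n alpha} P V r.

Definition succeeds_whp (R : numFieldType) (n alpha : nat) (P : protocol R n alpha)
  (good : R -> Prop) (V : dataset n alpha) : Prop :=
  exists A : {set seeds P},
    (forall r, r \in A -> good (output P V r)) /\
    (2 / 3 : R) * #|[set: seeds P]|%:R <= #|A|%:R.

(* lg m = floor(log2 m) + 1 : Theta(log m) and >= 1 (so "log n" is never 0). *)
Definition lg (m : nat) : nat := (trunc_log 2 m).+1.
Definition lgR (R : realType) (x : R) : nat := lg (Num.truncn x).

(* Main.v *)
Require Import Defs.
From HB Require Import structures.
From mathcomp Require Import all_boot all_order all_algebra.
From mathcomp Require Import reals.
From mathcomp Require Import ring lra zify.
Import Order.TTheory GRing.Theory Num.Theory.
Local Open Scope ring_scope.

(* Let mu_j be the number of servers holding item j, F1 = sum_j mu_j (which the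
   servers can report exactly) and D = sum_j (mu_j - 1)^+, so that F0 = F1 - D.
   Each collision count C(mu_j, 2) dominates (mu_j - 1)^2 / 2, hence
   D <= sum_j ((mu_j - 1)^+)^2 <= 2 C, and F0 <= F1 <= 3 F0.  It suffices to
   estimate D with additive error eps F0.  Sampling the universe pairwise
   independently at rate 2^-m, the rescaled value of D on the sample has variance
   at most 2^m * 2 C, so Chebyshev's inequality allows 2^m of order
   eps^2 F0^2 / C; the sample then contains about F1 / 2^m = O(C / (eps^2 F0))
   occurrences, which the servers send in full (unless Markov's bound is violated).
   The sample of level m is the set of j whose image under a random F_2-matrix with
   2 lg n rows starts with m zeros; the coordinator broadcasts this matrix.  Each
   server then emits one bit stream, its item counts at all levels followed by its
   items by decreasing level, so that a level-m sample is a prefix of the items. *)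

(** * Pairwise independent sampling levels *)

(** Right multiplication by [u] is onto with section [e], so each row is uniquely a kernel element
    plus some [b *m e]: rank-nullity as a product of cardinals. *)
Lemma card_left_kernel (F : finFieldType) (k t : nat) (u : 'M[F]_(k, t)) (e : 'M[F]_(t, k)) :
  e *m u = 1%:M ->
  (#|[set a : 'rV[F]_k | a *m u == 0%R]| * #|F| ^ t = #|F| ^ k)%N.
Proof.
move=> eu.
have -> : (#|F| ^ t = #|{: 'rV[F]_t}|)%N by rewrite card_mx mul1n.
have -> : (#|F| ^ k = #|{: 'rV[F]_k}|)%N by rewrite card_mx mul1n.
rewrite -cardsT -cardsX.
pose f (p : 'rV[F]_k * 'rV[F]_t) := p.1 + p.2 *m e.
have fu p : p.1 *m u = 0 -> f p *m u = p.2.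
  by move=> p1; rewrite mulmxDl p1 -mulmxA eu mulmx1 add0r.
rewrite -(@card_in_imset _ _ f) => [|p q].
  apply: eq_card => a; rewrite !inE; apply/imsetP.
  exists (a - a *m u *m e, a *m u); last by rewrite /f /= subrK.
  by rewrite !inE /= mulmxBl -(mulmxA _ e u) eu mulmx1 subrr eqxx.
rewrite !inE !andbT => /eqP p1 /eqP q1 E.
have E2 : p.2 = q.2 by rewrite -(fu p) // E fu.
move: E; rewrite /f E2 => /addIr E1.
by case: p q E1 E2 {p1 q1} => [? ?] [? ?] /= -> ->.
Qed.

Lemma card_bool_kernel1 (k : nat) (x : 'cV[bool]_k) : x != 0 ->
  (#|[set a : 'rV[bool]_k | a *m x == 0%R]| * 2 = 2 ^ k)%N.
Proof.
move=> x0.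
have /row_freeP [e ex] : row_free x^T.
  apply: inj_row_free => v /eqP; rewrite [v]mx11_scalar mul_scalar_mx scaler_eq0.
  by rewrite trmx_eq0 (negPf x0) orbF => /eqP ->; rewrite raddf0.
have := @card_left_kernel bool k 1 x e^T.
rewrite card_bool expn1; apply.
by rewrite -[x]trmxK -trmx_mul ex trmx1.
Qed.

(** Over the two-element field [bool], distinct nonzero vectors are linearly independent. This is
    the source of pairwise independence of the levels. *)
Lemma card_bool_kernel2 (k : nat) (x y : 'cV[bool]_k) : x != 0 -> y != 0 -> x != y ->
  (#|[set a : 'rV[bool]_k | (a *m x == 0%R) && (a *m y == 0%R)]| * 4 = 2 ^ k)%N.
Proof.
move=> x0 y0 xy; pose u := row_mx x y.
have /row_freeP [e ex] : row_free u^T.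
  apply: inj_row_free => v.
  rewrite /u tr_row_mx -[v]hsubmxK mul_row_col.
  rewrite [lsubmx v]mx11_scalar [rsubmx v]mx11_scalar !mul_scalar_mx.
  (* Four coefficient pairs over the two-element field. When both are one, [x = -y], hence [x = y]
     in characteristic two. *)
  case: (lsubmx v 0 0); case: (rsubmx v 0 0) => /=; rewrite ?scale1r ?scale0r ?addr0 ?add0r.
  - move=> /eqP; rewrite addr_eq0 => /eqP/matrixP E.
    case/eqP: xy; apply/matrixP=> i j.
    by move: (E j i); rewrite !mxE.
  - by move/eqP; rewrite trmx_eq0 (negPf x0).
  - by move/eqP; rewrite trmx_eq0 (negPf y0).
  - by rewrite !raddf0 row_mx0.
have := @card_left_kernel bool k (1 + 1)%N u e^T.
rewrite card_bool => <-.
  congr (_ * _)%N; apply: eq_card => a.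
  rewrite !inE /u mul_mx_row -[0 in RHS]row_mx0.
  apply/andP/eqP => [[/eqP-> /eqP->] // | /eq_row_mx [-> ->]]; by rewrite !eqxx.
by rewrite -[u]trmxK -trmx_mul ex trmx1.
Qed.

(** A hash matrix is a family of [M] rows: the first [m] are confined to [D], the others are
    free. *)
Lemma card_rows_in (T : finType) (M m : nat) (D : {set T}) : (m <= M)%N ->
  #|[set A : {ffun 'I_M -> T} | [forall i : 'I_M, (i < m)%N ==> (A i \in D)]]| =
  (#|D| ^ m * #|T| ^ (M - m))%N.
Proof.
move=> mM; pose Q (i : 'I_M) := if (i < m)%N then D else [set: T].
have -> : #|[set A : {ffun 'I_M -> T} | [forall i : 'I_M, (i < m)%N ==> (A i \in D)]]|
         = #|family Q|.
  apply: eq_card => A; rewrite inE; apply/forallP/familyP => H i; move: (H i);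
    by rewrite /Q; case: ifP; rewrite ?inE.
rewrite card_family /image_mem foldrE big_map big_enum /=.
rewrite (eq_bigr (fun i : 'I_M => if (i < m)%N then #|D| else #|T|)) => [|i _]; last first.
  by rewrite /Q; case: ifP; rewrite ?cardsT.
rewrite -(big_mkord xpredT (fun i => if (i < m)%N then #|D| else #|T|)).
rewrite (@big_cat_nat _ _ _ m) //=; congr (_ * _)%N.
  rewrite (eq_big_nat _ _ (F2 := fun=> #|D|)) ?prod_nat_const_nat ?subn0 // => i.
  by case/andP=> _ ->.
rewrite (eq_big_nat _ _ (F2 := fun=> #|T|)) ?prod_nat_const_nat // => i.
by case/andP=> mi _; rewrite ltnNge mi.
Qed.

Lemma ltn_exp_lg (n : nat) : (n < 2 ^ lg n)%N.
Proof. exact: trunc_log_ltn. Qed.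

(** Probabilities [2^-m] and [4^-m] are stated as exact counts of seeds. The level of [j] is the
    number of leading zeros of the random matrix applied to a nonzero vector attached to [j]. *)
Lemma pairwise_levels (n M : nat) :
  exists lev : seed (M * lg n) -> 'I_n -> nat,
    (forall j m, (m <= M)%N ->
       (#|[set s | (m <= lev s j)%N]| * 2 ^ m = #|{ffun 'I_(M * lg n) -> bool}|)%N) /\
    (forall j k m, j != k -> (m <= M)%N ->
       (#|[set s | (m <= lev s j)%N && (m <= lev s k)%N]| * 4 ^ m
         = #|{ffun 'I_(M * lg n) -> bool}|)%N).
Proof.
pose X : finType := {x : 'cV[bool]_(lg n) | x != 0}.
(* There are [2 ^ lg n - 1 >= n] nonzero vectors, enough for an injective labelling of the items. *)
have cX : (n <= #|X|)%N.
  rewrite card_sig (eq_card (B := predC1 (0 : 'cV[bool]_(lg n)))) // cardC1 card_mx card_bool muln1.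
  by rewrite -ltnS prednK ?expn_gt0 // ltn_exp_lg.
pose x (j : 'I_n) : X := enum_val (widen_ord cX j).
have xI : injective x by move=> i j /enum_val_inj /(congr1 val) /= /val_inj.
pose T : finType := {ffun 'I_M -> 'rV[bool]_(lg n)}.
have cT : #|{ffun 'I_(M * lg n) -> bool}| = #|T|.
  by rewrite !card_ffun card_mx !card_ord card_bool mul1n -expnM mulnC.
(* Any bijection from seeds to matrices will do, since only cardinals of events matter. *)
pose phi (s : seed (M * lg n)) : T := enum_val (cast_ord cT (enum_rank s)).
have phiB : bijective phi.
  apply: inj_card_bij; last by rewrite cT.
  by move=> s t /enum_val_inj /cast_ord_inj /enum_rank_inj.
(* If every row kills [x j], [find] returns the length [M], so levels are capped at [M]. *)
pose lev s j := find (fun i => phi s i *m val (x j) != 0) (enum 'I_M).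
have levE s j m : (m <= M)%N ->
    (m <= lev s j)%N = [forall i : 'I_M, (i < m)%N ==> (phi s i *m val (x j) == 0)].
  move=> mM; apply/idP/forallP => [H i|H].
    apply/implyP=> im; apply: contraFT (before_find i (leq_trans im H)).
    by rewrite nth_ord_enum.
  rewrite leqNgt; apply/negP=> lt_m.
  have lt_M := leq_trans lt_m mM; pose i := Ordinal lt_M.
  have : has (fun i => phi s i *m val (x j) != 0) (enum 'I_M).
    by rewrite has_find size_enum_ord.
  move/(nth_find i); rewrite -/(lev s j) -[lev s j]/(val i) nth_ord_enum.
  by rewrite (implyP (H i) lt_m).
exists lev; split=> [j m mM|j k m jk mM].
  pose D := [set a : 'rV_(lg n) | a *m val (x j) == 0].
  rewrite (_ : [set s | _] = phi @^-1: [set A : {ffun 'I_M -> 'rV[bool]_(lg n)} |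
      [forall i : 'I_M, (i < m)%N ==> (A i \in D)]]).
    rewrite on_card_preimset; last exact: onW_bij.
    rewrite card_rows_in // mulnAC -expnMn /D card_bool_kernel1; last exact: (valP (x j)).
    by rewrite cT card_ffun card_mx card_bool card_ord mul1n -expnD subnKC.
  apply/setP=> s; rewrite !inE levE //; apply: eq_forallb => i; by rewrite inE.
pose D := [set a : 'rV_(lg n) | (a *m val (x j) == 0) && (a *m val (x k) == 0)].
rewrite (_ : [set s | _] = phi @^-1: [set A : {ffun 'I_M -> 'rV[bool]_(lg n)} |
      [forall i : 'I_M, (i < m)%N ==> (A i \in D)]]).
  rewrite on_card_preimset; last exact: onW_bij.
  rewrite card_rows_in // mulnAC -expnMn /D card_bool_kernel2; first last.
  - by rewrite (inj_eq val_inj) (inj_eq xI).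
  - exact: (valP (x k)).
  - exact: (valP (x j)).
  by rewrite cT card_ffun card_mx card_bool card_ord mul1n -expnD subnKC.
apply/setP=> s; rewrite !inE !levE //; apply/andP/forallP => [[/forallP H1 /forallP H2] i|H].
  by rewrite inE; apply/implyP=> im; rewrite (implyP (H1 i)) ?(implyP (H2 i)).
by split; apply/forallP=> i; apply/implyP=> im; have := implyP (H i) im; rewrite inE => /andP[].
Qed.

(** * Broadcast a seed, then read prefixes of the servers' bit streams *)

Section Streaming.
Variables (R : Type) (n alpha sb q1 N : nat) (c : 'I_alpha).
Variables (stream : vec n -> seed sb -> nat -> bool)
  (q2 : {ffun 'I_alpha -> seq bool} -> 'I_alpha -> nat)
  (outf : {ffun 'I_alpha -> seq bool} -> R).

Definition ups (h : seq (bool * bool)) := [seq x.2 | x <- h & x.1].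
Definition downs (h : seq (bool * bool)) := [seq x.2 | x <- h & ~~ x.1].
Definition received (t : trans alpha) : {ffun 'I_alpha -> seq bool} :=
  [ffun a => ups (proj a t)].

Definition blocks (k : 'I_alpha -> nat) (up : bool) : seq ('I_alpha * bool) :=
  flatten [seq nseq (k a) (a, up) | a <- enum 'I_alpha].

Definition plan1 := blocks (fun=> sb) false ++ blocks (fun=> q1) true.
Definition plan2 (t : trans alpha) := blocks (q2 (received t)) true.

Definition seed_bit (s : seed sb) (i : nat) : bool :=
  if insub i is Some j then s j else false.

(** The second plan is read off the transcript truncated to the first phase, so later bits cannot
    alter it. Past the end, [onth] gives [None], that is, halt. *)
Definition stream_sched (v : vec n) (s : seed sb) (t : trans alpha) :=
  onth (plan1 ++ (if (size t < size plan1)%N then [::]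
                  else plan2 (take (size plan1) t))) (size t).

(** The server decodes the common seed from its downward bits; the number of bits it has already
    sent is its position in the stream. *)
Definition stream_pmsg (a : 'I_alpha) (v : vec n) (_ : seed sb) (h : seq (bool * bool)) :=
  stream v [ffun i : 'I_sb => nth false (downs h) i] (size (ups h)).

Definition stream_cmsg (v : vec n) (s : seed sb) (t : trans alpha) :=
  if stream_sched v s t is Some (a, _) then seed_bit s (size (proj a t)) else false.

Definition streaming : protocol R n alpha :=
  @Protocol R n alpha c sb N stream_sched stream_pmsg stream_cmsg
    (fun _ _ t => outf (received t)).

Lemma size_blocks k up : size (blocks k up) = (\sum_a k a)%N.
Proof.
rewrite size_flatten /shape -map_comp sumnE big_map big_enum /=.
by apply: eq_bigr => a _; rewrite /= size_nseq.
Qed.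

Lemma count_blocks k up a : count (fun x => x.1 == a) (blocks k up) = k a.
Proof.
rewrite count_flatten -map_comp sumnE big_map big_enum /= (bigD1 a) //=.
rewrite count_nseq eqxx mul1n big1 ?addn0 // => b /negPf ba.
by rewrite count_nseq /= ba.
Qed.

Lemma all_blocks k up : all (fun x => x.2 == up) (blocks k up).
Proof.
apply/allP => x /flattenP [s /mapP [a _ ->]].
by rewrite mem_nseq => /andP [_ /eqP ->] /=.
Qed.

Variables (V : dataset n alpha) (r : seeds streaming).
Let s : seed sb := r c.

Fixpoint fill (L : seq ('I_alpha * bool)) (t : trans alpha) : trans alpha :=
  if L is (a, up) :: L' then
    fill L' (rcons t (a, up, if up then stream_pmsg a (V a) (r a) (proj a t)
                             else seed_bit s (size (proj a t))))
  else t.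

Lemma size_fill L t : size (fill L t) = (size t + size L)%N.
Proof.
elim: L t => [|[a up] L IH] t /=; first by rewrite addn0.
by rewrite IH size_rcons addSnnS.
Qed.

Lemma take_fill L t : take (size t) (fill L t) = t.
Proof.
elim: L t => [|[a up] L IH] t /=; first exact: take_size.
set t1 := rcons _ _.
have -> : take (size t) (fill L t1) = take (size t) (take (size t1) (fill L t1)).
  by rewrite take_takel // size_rcons leqW.
by rewrite IH /t1 -cats1 take_size_cat.
Qed.

Lemma fill_cat L L' t : fill (L ++ L') t = fill L' (fill L t).
Proof. by elim: L t => [|[a up] L IH] t //=. Qed.

(** The scheduler is required to follow [L] on every short extension of [t], not only on the actual
    run; this makes the hypothesis stable under the induction. *)
Lemma run_fill L t k :
  (forall t', take (size t) t' = t -> (size t' < size t + size L)%N ->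
     stream_sched (V c) s t' = onth L (size t' - size t)) ->
  run streaming V r (size L + k) t = run streaming V r k (fill L t).
Proof.
elim: L t => [|[a up] L IH] t //= H.
have Ht : stream_sched (V c) s t = Some (a, up).
  by rewrite H ?take_size ?subnn // addnS ltnS leq_addr.
rewrite /step /= -/s Ht.
have -> : stream_cmsg (V c) s t = seed_bit s (size (proj a t)) by rewrite /stream_cmsg Ht.
set t1 := rcons _ _; have st1 : size t1 = (size t).+1 by rewrite size_rcons.
have tt1 : take (size t) t1 = t by rewrite /t1 -cats1 take_size_cat.
apply: IH => t' E lt; rewrite st1 in E lt *.
have st : (size t < size t')%N.
  by have := congr1 size E; rewrite size_take_min st1; lia.
rewrite H; last by rewrite addnS -addSn.
  by rewrite -[(size t' - size t)%N]prednK ?subn_gt0 // subnS.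
by rewrite -(take_takel _ (leqnSn _)) E.
Qed.

Lemma proj_rcons (a : 'I_alpha) (t : trans alpha) x :
  proj a (rcons t x) = if x.1.1 == a then rcons (proj a t) (x.1.2, x.2) else proj a t.
Proof. by rewrite /proj filter_rcons; case: ifP => // _; rewrite map_rcons. Qed.

(** The invariant shape of a channel: [d] seed bits down, then [u] stream bits up. *)
Definition hist (d u : nat) (a : 'I_alpha) : seq (bool * bool) :=
  mkseq (fun i => (false, seed_bit s i)) d ++ mkseq (fun i => (true, stream (V a) s i)) u.

Lemma ups_hist d u a : ups (hist d u a) = mkseq (stream (V a) s) u.
Proof.
rewrite /ups filter_cat map_cat /mkseq.
rewrite !filter_map (eq_filter (a2 := pred0)) // filter_pred0 /=.
by rewrite (eq_filter (a2 := predT)) // filter_predT -map_comp.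
Qed.

Lemma downs_hist d u a : downs (hist d u a) = mkseq (seed_bit s) d.
Proof.
rewrite /downs filter_cat map_cat /mkseq.
rewrite !filter_map (eq_filter (a2 := predT)) // filter_predT.
by rewrite (eq_filter (a2 := pred0)) // filter_pred0 /= cats0 -map_comp.
Qed.

(** Counters are kept per channel. A channel that has carried only seed bits has length equal to the
    index of the next seed bit. *)
Lemma fill_down L t (d : 'I_alpha -> nat) : all (fun x => x.2 == false) L ->
  (forall a, proj a t = hist (d a) 0 a) ->
  forall a, proj a (fill L t) = hist (d a + count (fun x => x.1 == a) L) 0 a.
Proof.
elim: L t d => [|[b up] L IH] t d /= => [_ H a|/andP[/eqP -> HL] H a]; first by rewrite H addn0.
rewrite (IH _ (fun a => d a + (b == a))%N) // => [|e]; first by rewrite addnA.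
rewrite proj_rcons /=; case: eqP => [->|_]; last by rewrite addn0.
by rewrite H /hist !cats0 addn1 mkseqS size_mkseq.
Qed.

Lemma stream_pmsg_hist u a rr : stream_pmsg a (V a) rr (hist sb u a) = stream (V a) s u.
Proof.
rewrite /stream_pmsg ups_hist size_mkseq downs_hist; congr stream.
by apply/ffunP=> i; rewrite ffunE nth_mkseq // /seed_bit valK.
Qed.

Lemma fill_up L t (u : 'I_alpha -> nat) : all (fun x => x.2 == true) L ->
  (forall a, proj a t = hist sb (u a) a) ->
  forall a, proj a (fill L t) = hist sb (u a + count (fun x => x.1 == a) L) a.
Proof.
elim: L t u => [|[b up] L IH] t u /= => [_ H a|/andP[/eqP -> HL] H a]; first by rewrite H addn0.
rewrite (IH _ (fun a => u a + (b == a))%N) // => [|e]; first by rewrite addnA.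
rewrite proj_rcons /=; case: eqP => [->|_]; last by rewrite addn0.
by rewrite H stream_pmsg_hist /hist addn1 mkseqS rcons_cat.
Qed.

Let bits1 := [ffun a => mkseq (stream (V a) s) q1].
Let bits2 := [ffun a => mkseq (stream (V a) s) (q1 + q2 bits1 a)].

(** Both phases extend the same stream, so the coordinator ends with one prefix per server. The
    hypothesis ensures that the bound [N] does not cut the run short. *)
Lemma streaming_run :
  (alpha * (sb + q1) + \sum_a q2 bits1 a <= N)%N ->
  output streaming V r = outf bits2 /\
  size (transcript streaming V r) = (alpha * (sb + q1) + \sum_a q2 bits1 a)%N.
Proof.
move=> le_N.
pose t1 := fill plan1 [::].
have st1 : size t1 = size plan1 by rewrite size_fill.
have p1 a : proj a t1 = hist sb q1 a.
  rewrite /t1 /plan1 fill_cat (fill_up _ _ (fun=> 0%N)) ?all_blocks ?count_blocks //.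
  by move=> b; rewrite (fill_down _ _ (fun=> 0%N)) ?all_blocks ?count_blocks.
have b1 : received t1 = bits1 by apply/ffunP=> a; rewrite !ffunE p1 ups_hist.
pose t2 := fill (plan2 t1) t1.
have p2 a : proj a t2 = hist sb (q1 + q2 bits1 a) a.
  by rewrite /t2 /plan2 (fill_up _ _ (fun=> q1)) ?all_blocks ?count_blocks // b1.
have sp1 : size plan1 = (alpha * (sb + q1))%N.
  by rewrite /plan1 size_cat !size_blocks !sum_nat_const card_ord mulnDr.
have sp2 : size (plan2 t1) = (\sum_a q2 bits1 a)%N.
  by rewrite size_blocks b1.
have st2 : size t2 = (alpha * (sb + q1) + \sum_a q2 bits1 a)%N.
  by rewrite size_fill st1 sp1 sp2.
have after_t1 t' : take (size t1) t' = t1 -> stream_sched (V c) s t' =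
    onth (plan2 t1) (size t' - size t1).
  move=> E; have lt : (size t1 <= size t')%N.
    by have := congr1 size E; rewrite size_take_min; lia.
  by rewrite /stream_sched ltnNge -st1 lt /= E onth_cat -st1 ltnNge lt.
have tE : transcript streaming V r = t2.
  rewrite /transcript [rounds _]/=.
  have -> : N = (size plan1 + (size (plan2 t1) + (N - size t2)))%N.
    by rewrite addnA sp1 sp2 st2 subnKC.
  rewrite run_fill => [|t' _ /= lt]; last first.
    by rewrite /stream_sched subn0 lt cats0.
  rewrite run_fill => [|t' /after_t1 //].
  (* In the leftover rounds the plan is exhausted and the scheduler halts. *)
  case: (N - size t2)%N => [//|k] /=; rewrite /step /= after_t1 ?take_fill //.
  by rewrite onth_default // size_fill addKn.
split; last by rewrite tE.
rewrite /output tE /=; congr outf; apply/ffunP=> a.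
by rewrite [in LHS]ffunE p2 ups_hist [RHS]ffunE.
Qed.
End Streaming.

(** * Moments of the sample *)

Section Sampling.
Variables (R : realFieldType) (T I : finType) (S : T -> I -> bool) (q : nat).
Hypothesis card_S : forall j, (#|[set s | S s j]| * q = #|T|)%N.
Hypothesis card_SS : forall j k, j != k ->
  (#|[set s | S s j && S s k]| * q ^ 2 = #|T|)%N.
Variable w : I -> nat.

Let sampled s := (\sum_j S s j * w j)%N.
Let total := (\sum_j w j)%N.

Lemma sum_sampled : (\sum_s sampled s * q = #|T| * total)%N.
Proof.
rewrite -big_distrl exchange_big /= big_distrl big_distrr; apply: eq_bigr => j _ /=.
rewrite -big_distrl /= -(card_S j) [RHS]mulnAC; congr (_ * _ * _)%N.
by rewrite -sum1dep_card [RHS]big_mkcond /=; apply: eq_bigr => s _; case: (S s j).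
Qed.

(** The variance bound for Chebyshev. The centred indicators [X s j] are pairwise uncorrelated, so
    only the diagonal survives, where the mean square is [q - 1 <= q]. *)
Lemma sum_sampled_sqr :
  \sum_s (q%:R * (sampled s)%:R - total%:R) ^+ 2
    <= #|T|%:R * q%:R * (\sum_j w j ^ 2)%:R :> R.
Proof.
pose X s j : R := q%:R * (S s j)%:R - 1.
have card_sum (P : pred T) : \sum_s (P s)%:R = #|[set s | P s]|%:R :> R.
  rewrite -sum1dep_card natr_sum [RHS]big_mkcond /=.
  by apply: eq_bigr => s _; case: (P s).
have sum1 : \sum_(s : T) 1 = #|T|%:R :> R by rewrite sumr_const.
have XX j k : j != k -> \sum_s X s j * X s k = 0.
  move=> jk.
  have /(congr1 (fun x => x%:R : R)) := card_SS _ _ jk; rewrite natrM natrX => E2.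
  have /(congr1 (fun x => x%:R : R)) := card_S j; rewrite natrM => Ej.
  have /(congr1 (fun x => x%:R : R)) := card_S k; rewrite natrM => Ek.
  rewrite (eq_bigr (fun s => q%:R ^+ 2 * (S s j && S s k)%:R - q%:R * (S s j)%:R
     - q%:R * (S s k)%:R + 1)) => [|s _]; last first.
    by rewrite /X; case: (S s j); case: (S s k) => /=; ring.
  rewrite big_split /= 2!sumrB -!mulr_sumr !card_sum sum1.
  by rewrite mulrC E2 mulrC Ej mulrC Ek; ring.
have XX1 j : \sum_s X s j * X s j <= #|T|%:R * q%:R.
  have /(congr1 (fun x => x%:R : R)) := card_S j; rewrite natrM => Ej.
  rewrite (eq_bigr (fun s => (q%:R ^+ 2 - 2 * q%:R) * (S s j)%:R + 1)) => [|s _]; last first.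
    by rewrite /X; case: (S s j) => /=; ring.
  rewrite big_split /= -!mulr_sumr !card_sum sum1 -Ej.
  have := mulr_ge0 (ler0n R #|[set s | S s j]|) (ler0n R q); lra.
rewrite (eq_bigr (fun s => \sum_j \sum_k ((w j)%:R * (w k)%:R) * (X s j * X s k)))
  => [|s _]; last first.
  have -> : q%:R * (sampled s)%:R - total%:R = \sum_j (w j)%:R * X s j.
    rewrite /sampled /total !natr_sum mulr_sumr -sumrB; apply: eq_bigr => j _.
    by rewrite natrM /X; ring.
  rewrite expr2 mulr_suml; apply: eq_bigr => j _; rewrite mulr_sumr.
  by apply: eq_bigr => k _; ring.
rewrite exchange_big natr_sum mulr_sumr /=; apply: ler_sum => j _.
rewrite exchange_big (bigD1 j) //= [X in _ + X]big1 => [|k kj]; last first.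
  by rewrite -mulr_sumr XX ?mulr0 // eq_sym.
rewrite addr0 -mulr_sumr natrX -expr2 mulrC ler_wpM2r ?exprn_ge0 ?ler0n //.
Qed.
End Sampling.

(** * Item multiplicities and pairwise collisions *)

Section Multiplicity.
Variables (n alpha : nat) (V : dataset n alpha).

Definition mult (j : 'I_n) : nat := #|[set a | V a j]|.

Lemma sum_mult (P : pred 'I_n) :
  (\sum_a #|[set j | V a j && P j]| = \sum_j P j * mult j)%N.
Proof.
rewrite (eq_bigr (fun a => \sum_j (V a j && P j))%N) => [|a _]; last first.
  by rewrite -sum1dep_card big_mkcond; apply: eq_bigr => j _; case: (_ && _).
rewrite exchange_big; apply: eq_bigr => j _ /=.
rewrite /mult -sum1dep_card [in RHS]big_mkcond big_distrr; apply: eq_bigr => a _ /=.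
by case: (V a j); case: (P j).
Qed.

Lemma card_union (P : pred 'I_n) :
  #|[set j | [exists a, V a j && P j]]| = (\sum_j P j * (0 < mult j))%N.
Proof.
rewrite -sum1dep_card big_mkcond /=; apply: eq_bigr => j _.
have -> : (0 < mult j)%N = [exists a, V a j].
  by apply/card_gt0P/existsP => [][a]; rewrite ?inE => H; exists a; rewrite ?inE.
have -> : [exists a, V a j && P j] = [exists a, V a j] && P j.
  apply/existsP/andP => [[a /andP[Va Pj]]|[/existsP[a Va] Pj]].
    by split=> //; apply/existsP; exists a.
  by exists a; rewrite Va.
by case: (P j); case: [exists a, V a j].
Qed.

Lemma sum_sqr_pred_mult : (\sum_j (mult j).-1 ^ 2 <= 2 * collisions V)%N.
Proof.
pose B j := [set p : 'I_alpha * 'I_alpha | [&& (p.1 < p.2)%N, V p.1 j & V p.2 j]].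
have -> : collisions V = (\sum_j #|B j|)%N.
  rewrite /collisions -sum1dep_card.
  rewrite (eq_bigr (fun j => \sum_(p | p \in B j) 1)%N) => [|j _]; last by rewrite sum1_card.
  rewrite (exchange_big_dep predT) //= pair_big_dep /=; apply: eq_bigl => -[p j] /=.
  by rewrite inE.
rewrite big_distrr; apply: leq_sum => j _ /=.
pose A := [set a | V a j].
(* The square of the set of holders of [j] is covered by the diagonal, the increasing pairs [B j]
   and their mirror images. *)
have : (mult j * mult j <= mult j + (#|B j| + #|B j|))%N.
  rewrite -cardsX -/A.
  pose sw (p : 'I_alpha * 'I_alpha) := (p.2, p.1).
  have swI : injective sw by move=> [a b] [c d] [-> ->].
  rewrite -{2}(card_imset (B j) swI).
  have dI : injective (fun a : 'I_alpha => (a, a)) by move=> a b [].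
  rewrite -[X in (_ <= X + _)%N](card_imset A dI).
  apply: leq_trans (leq_add (leqnn _) (leq_card_setU _ _)).
  apply: leq_trans (leq_card_setU _ _).
  apply: subset_leq_card; apply/subsetP => -[a b]; rewrite !inE /= => /andP[aj bj].
  case: (ltngtP a b) => ab.
  - by rewrite aj bj orbT.
  - apply/orP; right; apply/orP; right; apply/imsetP; exists (b, a) => //.
    by rewrite inE /= ab aj bj.
  - apply/orP; left; apply/imsetP; exists a; rewrite ?inE //.
    by congr (_, _); apply/val_inj.
by case: (mult j) => [|k] /=; nia.
Qed.
End Multiplicity.
Arguments mult {n alpha} V j.

(** * The estimator *)

Lemma binary_digits (l x : nat) : (x < 2 ^ l)%N ->
  (\sum_(k < l) odd (x %/ 2 ^ k) * 2 ^ k = x)%N.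
Proof.
elim: l x => [|l IH] x; first by rewrite expn0 ltnS leqn0 big_ord0 => /eqP.
rewrite expnS => xl; rewrite big_ord_recl expn0 divn1 muln1.
rewrite (eq_bigr (fun k : 'I_l => 2 * (odd (x./2 %/ 2 ^ k) * 2 ^ k))%N) => [|k _].
  by rewrite -big_distrr IH /= ?mul2n ?odd_double_half // -divn2 ltn_divLR // mulnC.
by rewrite lift0 expnS divnMA divn2; lia.
Qed.

(** In a nonincreasing list the entries of value at least [m] form a prefix; hence a single stream
    order serves all sampling levels. *)
Lemma take_count_sorted (T : eqType) (f : T -> nat) (m : nat) (l : seq T) :
  sorted (fun x y => f y <= f x)%N l ->
  take (count (fun x => m <= f x)%N l) l = [seq x <- l | (m <= f x)%N].
Proof.
elim: l => [//|x l IH] /= xl.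
have xs := path_sorted xl.
case: leqP => [_|lt_m] /=; first by rewrite IH.
have /allP H : all (fun y => f y <= f x)%N l.
  by apply: order_path_min xl => ? ? ? /[swap]; apply: leq_trans.
have no : {in l, (fun y => m <= f y)%N =1 pred0}.
  by move=> y yl; apply/negbTE; rewrite -ltnNge (leq_ltn_trans (H _ yl)).
by rewrite (eq_in_count no) (eq_in_filter no) count_pred0 filter_pred0.
Qed.

(** * Encoding of counts and items, and the two-phase estimator *)

Section Estimator.
Variables (R : realType) (n alpha sb M C : nat) (eps : R) (c : 'I_alpha).
Variable lev : seed sb -> 'I_n -> nat.
Let l := lg n.

Definition held (v : vec n) (s : seed sb) : seq 'I_n :=
  sort (fun i j => lev s j <= lev s i)%N (enum [set j | v j]).

Definition words (v : vec n) (s : seed sb) : seq nat :=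
  [seq #|[set j | v j && (m <= lev s j)%N]| | m <- iota 0 M.+1] ++ [seq val j | j <- held v s].

Definition word_stream (v : vec n) (s : seed sb) (k : nat) : bool :=
  odd (nth 0 (words v s) (k %/ l) %/ 2 ^ (k %% l))%N.

Definition word (f : seq bool) (i : nat) : nat :=
  (\sum_(k < l) nth false f (i * l + k) * 2 ^ k)%N.

(** Counts are at most [n] and items below [n], so each word fits in [l] bits. Beyond the list the
    default word is zero, which also fits. *)
Lemma word_mkseq v s u i : (i.+1 * l <= u)%N ->
  word (mkseq (word_stream v s) u) i = nth 0%N (words v s) i.
Proof.
move=> iu; rewrite /word -[RHS](@binary_digits l); last first.
  have [ilt|?] := ltnP i (size (words v s)); last by rewrite nth_default ?expn_gt0.
  have : (nth 0%N (words v s) i \in words v s) by exact: mem_nth.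
  rewrite mem_cat => /orP[] /mapP [x _ ->]; last exact: ltn_trans (ltn_ord x) (ltn_exp_lg n).
  by apply: leq_ltn_trans (max_card _) _; rewrite card_ord ltn_exp_lg.
apply: eq_bigr => k _; rewrite nth_mkseq; last first.
  by apply: leq_trans iu; rewrite mulSn addnC ltn_add2r.
by rewrite /word_stream divnMDl // (divn_small (ltn_ord k)) addn0 modnMDl modn_small.
Qed.

Lemma nth_words_count v s m : (m <= M)%N ->
  nth 0%N (words v s) m = #|[set j | v j && (m <= lev s j)%N]|.
Proof.
move=> mM; rewrite /words nth_cat size_map size_iota ltnS mM.
by rewrite (nth_map 0%N) ?size_iota // nth_iota.
Qed.

Lemma count_held v s m :
  count (fun j => m <= lev s j)%N (held v s) = #|[set j | v j && (m <= lev s j)%N]|.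
Proof.
rewrite -size_filter -(card_uniqP _); last by rewrite filter_uniq ?sort_uniq ?enum_uniq.
by apply: eq_card => j; rewrite mem_filter mem_sort mem_enum !inE andbC.
Qed.

Lemma nth_words_items v s m (j : 'I_n) :
  (val j \in [seq nth 0%N (words v s) (M.+1 + i) |
     i <- iota 0 #|[set j | v j && (m <= lev s j)%N]|]) = v j && (m <= lev s j)%N.
Proof.
rewrite (eq_map (g := nth 0%N [seq val j | j <- held v s])) => [|i]; last first.
  by rewrite /words nth_cat size_map size_iota ltnNge leq_addr addKn.
rewrite map_nth_iota0; last by rewrite size_map -count_held count_size.
rewrite -map_take -count_held take_count_sorted; last first.
  by apply: sort_sorted => ? ?; apply: leq_total.
by rewrite (mem_map val_inj) mem_filter mem_sort mem_enum inE andbC.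
Qed.

(* 108 = 12 * 3 ^ 2 : the coordinator only knows F1, and F1 <= 3 F0. *)
Definition level (F1 : nat) : nat :=
  trunc_log 2 (Num.truncn (eps ^+ 2 * F1%:R ^+ 2 / (108 * C%:R))).

(** The Markov cutoff: [2 ^ m * X] has mean [F1], so the test against [6 * F1] caps the second phase
    on every seed and rarely fails. For [C = 0] there is no second phase. *)
Definition go (F1 X : nat) : bool := (0 < C)%N && (2 ^ level F1 * X <= 6 * F1)%N.

Definition got (f : {ffun 'I_alpha -> seq bool}) (m : nat) : nat :=
  (\sum_a word (f a) m)%N.

Definition got_distinct (f : {ffun 'I_alpha -> seq bool}) (m : nat) : nat :=
  #|[set j : 'I_n | [exists a,
     val j \in [seq word (f a) (M.+1 + i) | i <- iota 0 (word (f a) m)]]]|.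

Definition more (f : {ffun 'I_alpha -> seq bool}) (a : 'I_alpha) : nat :=
  let F1 := got f 0 in let m := level F1 in
  if go F1 (got f m) then (l * word (f a) m)%N else 0%N.

(** Occurrences minus distinct items in the sample is the sampled part of [D], rescaled by [2 ^+ m]
    and subtracted from [F1]. *)
Definition estimate (f : {ffun 'I_alpha -> seq bool}) : R :=
  let F1 := got f 0 in let m := level F1 in
  if go F1 (got f m) then F1%:R - 2 ^+ m * ((got f m)%:R - (got_distinct f m)%:R)
  else F1%:R.

Definition estimator : protocol R n alpha :=
  streaming R n alpha sb (l * M.+1) (alpha * (sb + l * M.+1) + l * (alpha * n))
    c word_stream more estimate.

Lemma estimator_run (V : dataset n alpha) (r : seeds estimator) :
  let s := r c in
  let F1 := (\sum_j mult V j)%N in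
  let m := level F1 in
  let X := (\sum_j (m <= lev s j) * mult V j)%N in
  (m <= M)%N ->
  output estimator V r =
    (if go F1 X then F1%:R - 2 ^+ m * (\sum_j (m <= lev s j) * (mult V j).-1)%N%:R
     else F1%:R) /\
  size (transcript estimator V r) =
    (alpha * (sb + l * M.+1) + (if go F1 X then l * X else 0))%N.
Proof.
move=> s F1 m X mM.
have cntE u a i : (i <= M)%N -> (l * M.+1 <= u)%N ->
    word (mkseq (word_stream (V a) s) u) i = #|[set j | V a j && (i <= lev s j)%N]|.
  move=> iM lu; rewrite word_mkseq ?nth_words_count //.
  by apply: leq_trans lu; rewrite mulnC leq_mul2l ltnS iM orbT.
(* The extra length [u] is arbitrary because the counts lie in the first [M.+1] words: the test [go]
   gives the same answer after phase one and at the end. *)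
have gotE (f : {ffun 'I_alpha -> seq bool}) (u : 'I_alpha -> nat) i :
    (forall a, f a = mkseq (word_stream (V a) s) (l * M.+1 + u a)) -> (i <= M)%N ->
    got f i = (\sum_j (i <= lev s j) * mult V j)%N.
  move=> fE iM; rewrite -sum_mult; apply: eq_bigr => a _.
  by rewrite fE cntE ?leq_addr.
have got0 (f : {ffun 'I_alpha -> seq bool}) (u : 'I_alpha -> nat) :
    (forall a, f a = mkseq (word_stream (V a) s) (l * M.+1 + u a)) ->
    got f 0 = F1.
  by move=> fE; rewrite (gotE _ _ _ fE) //; apply: eq_bigr => j _; rewrite mul1n.
pose b1 : {ffun 'I_alpha -> seq bool} := [ffun a => mkseq (word_stream (V a) s) (l * M.+1)].
have b1E a : b1 a = mkseq (word_stream (V a) s) (l * M.+1 + (fun=> 0) a)%N.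
  by rewrite ffunE addn0.
have moreE a : more b1 a = if go F1 X then (l * #|[set j | V a j && (m <= lev s j)%N]|)%N else 0%N.
  by rewrite /more (got0 _ _ b1E) -/m (gotE _ _ _ b1E) // -/X b1E cntE ?leq_addr.
have sum_more : (\sum_a more b1 a = if go F1 X then l * X else 0)%N.
  rewrite (eq_bigr _ (fun a _ => moreE a)); case: (go F1 X); last by rewrite big1.
  by rewrite -big_distrr /= sum_mult.
have X_le : (X <= alpha * n)%N.
  rewrite /X -sum_mult -[X in (_ <= X * _)%N]card_ord -sum_nat_const.
  by apply: leq_sum => a _; rewrite -[X in (_ <= X)%N]card_ord max_card.
have [|-> ->] := streaming_run R n alpha sb (l * M.+1)
   (alpha * (sb + l * M.+1) + l * (alpha * n)) c word_stream more estimate V r.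
  by rewrite -/b1 sum_more leq_add2l; case: go => //; rewrite leq_mul2l X_le orbT.
split; last by rewrite -/b1 sum_more.
rewrite /estimate; set f := finfun _.
have fE a : f a = mkseq (word_stream (V a) s) (l * M.+1 + more b1 a) by rewrite ffunE.
rewrite (got0 _ _ fE) -/m (gotE _ _ _ fE) // -/X.
case: ifP => [gT|//]; congr (_ - _ * _).
have -> : got_distinct f m = (\sum_j (m <= lev s j) * (0 < mult V j))%N.
  rewrite -card_union; apply: eq_card => j; rewrite !inE.
  apply: eq_existsb => a.
  rewrite fE cntE ?leq_addr // -[RHS](nth_words_items (V a) s m).
  congr (_ \in _); apply/eq_in_map => i; rewrite mem_iota add0n leq0n => /= i_lt.
  rewrite word_mkseq // moreE gT -mulnDr mulnC leq_mul2l.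
  by rewrite -addnS leq_add2l i_lt orbT.
(* Each multiplicity is its predecessor plus the indicator that it is positive. *)
have -> : X = (\sum_j (m <= lev s j) * (mult V j).-1
               + \sum_j (m <= lev s j) * (0 < mult V j))%N.
  rewrite -big_split; apply: eq_bigr => j _ /=; rewrite -mulnDr.
  by case: (mult V j) => //= k; rewrite addn1.
by rewrite natrD addrK.
Qed.
End Estimator.

(** * Cost and success probability *)

(** An event depending on one server's seed has the same probability among joint seeds; this
    transfers success from the coordinator's seed to all seeds. *)
Lemma card_coordinate (I T : finType) (c : I) (E : {set T}) :
  (#|[set f : {ffun I -> T} | f c \in E]| * #|T| = #|E| * #|{: {ffun I -> T}}|)%N.
Proof.
pose Q (i : I) := if i == c then E else [set: T].
have -> : #|[set f : {ffun I -> T} | f c \in E]| = #|family Q|.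
  apply: eq_card => f; rewrite inE; apply/idP/familyP => [fE i|/(_ c)].
    by rewrite /Q; case: eqP => [->|] //; rewrite inE.
  by rewrite /Q eqxx.
rewrite card_ffun -prod_nat_const (bigD1 c) //=.
rewrite card_family /image_mem foldrE big_map big_enum /= (bigD1 c) //= {1}/Q eqxx.
rewrite (eq_bigr (fun=> #|T|)) => [|i /negPf ic]; last by rewrite /Q ic cardsT.
by rewrite -mulnA [(_ * #|T|)%N]mulnC.
Qed.

Lemma sum_mult_F0 (n alpha : nat) (V : dataset n alpha) :
  (\sum_j mult V j = F0 V + \sum_j (mult V j).-1)%N.
Proof.
have -> : F0 V = (\sum_j true * (0 < mult V j))%N.
  rewrite -card_union; apply: eq_card => j; rewrite !inE; apply: eq_existsb => a.
  by rewrite andbT.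
rewrite -big_split; apply: eq_bigr => j _ /=; rewrite mul1n.
by case: (mult V j) => //= k; rewrite add1n.
Qed.

Lemma sum_pred_mult_le (n alpha : nat) (V : dataset n alpha) :
  (\sum_j (mult V j).-1 <= 2 * collisions V)%N.
Proof.
apply: leq_trans (sum_sqr_pred_mult n alpha V); apply: leq_sum => j _.
by rewrite -[X in (X <= _)%N]muln1 leq_mul2l; case: (mult V j) => [|[|k]].
Qed.

(** * Bounds on the sampling level *)

Section Level.
Variables (R : realType) (C : nat) (eps : R) (F1 : nat).
Hypotheses (C_gt0 : (0 < C)%N).
Let x := eps ^+ 2 * F1%:R ^+ 2 / (108 * C%:R).
Let m := level R C eps F1.

Let x_ge0 : 0 <= x.
Proof. by apply: divr_ge0; rewrite mulr_ge0 // sqr_ge0. Qed.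

(** Positivity of [m] matters: for [x < 1] the level is zero while [2 ^+ 0] exceeds [x]. *)
Lemma exp_level_le : (0 < m)%N -> 2 ^+ m <= x.
Proof.
rewrite /m /level -/x => m_gt0.
have /andP[tx _] := truncn_itv x_ge0; apply: le_trans tx.
rewrite -natrX ler_nat trunc_logP //.
by case: (Num.truncn x) m_gt0.
Qed.

Lemma exp_level_gt : x < 2 ^+ m.+1.
Proof.
have /andP[_ tx] := truncn_itv x_ge0; apply: lt_le_trans tx _.
by rewrite -natrX ler_nat trunc_log_ltn.
Qed.

(** Here [x <= 9 * n ^ 2 / 108 <= n ^ 2 < 2 ^ (2 * lg n)], so [2 * lg n] matrix rows suffice. *)
Lemma level_le (n : nat) : (0 < n)%N -> (F1 <= 3 * n)%N -> 0 < eps -> eps < 1 ->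
  (m <= 2 * lg n)%N.
Proof.
move=> n_gt0 F1n e0 e1; rewrite leqNgt; apply/negP => lt.
have m0 : (0 < m)%N by apply: leq_ltn_trans lt.
have : (2 ^+ (2 * lg n) : R) <= n%:R ^+ 2.
  apply: le_trans (_ : 2 ^+ m <= _); first by rewrite ler_weXn2l ?ler1n ?(ltnW lt).
  apply: le_trans (exp_level_le m0) _.
  have F1n' : F1%:R <= 3 * n%:R :> R by rewrite -natrM ler_nat.
  have C1 : 1 <= C%:R :> R by rewrite ler1n.
  rewrite /x ler_pdivrMr ?mulr_gt0 ?ltr0n //.
  have : F1%:R ^+ 2 <= (3 * n%:R) ^+ 2 :> R by rewrite ler_sqr ?nnegrE ?mulr_ge0 ?ler0n.
  have : eps ^+ 2 <= 1 by rewrite expr_le1 // ltW.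
  have : 0 <= eps ^+ 2 by rewrite sqr_ge0.
  have : 0 <= n%:R ^+ 2 :> R by rewrite sqr_ge0.
  nra.
by rewrite mulnC exprM -!natrX ler_nat leq_sqr leqNgt ltn_exp_lg.
Qed.
End Level.

(** * Failure events of the sample *)

Section Success.
Variables (R : realType) (n alpha sb M C : nat) (eps : R) (lev : seed sb -> 'I_n -> nat).
Hypothesis lev1 : forall j m, (m <= M)%N ->
  (#|[set s | (m <= lev s j)%N]| * 2 ^ m = #|{ffun 'I_sb -> bool}|)%N.
Hypothesis lev2 : forall j k m, j != k -> (m <= M)%N ->
  (#|[set s | (m <= lev s j)%N && (m <= lev s k)%N]| * 4 ^ m = #|{ffun 'I_sb -> bool}|)%N.
Variable V : dataset n alpha.
Hypotheses (coll_le : (collisions V <= C)%N) (C_le : (C <= F0 V)%N) (C_gt0 : (0 < C)%N).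
Hypothesis eps_gt0 : 0 < eps.
Let mu := mult V.
Let F1 := (\sum_j mu j)%N.
Let m := level R C eps F1.
Let D := (\sum_j (mu j).-1)%N.
Let X s := (\sum_j (m <= lev s j) * mu j)%N.
Let Z s := (\sum_j (m <= lev s j) * (mu j).-1)%N.
Hypothesis m_le : (m <= M)%N.

Let F0_gt0 : (0 < F0 V)%N. Proof. exact: leq_trans C_gt0 C_le. Qed.
Let F1E : F1 = (F0 V + D)%N. Proof. exact: sum_mult_F0. Qed.
Let F1_le : (F1 <= 3 * F0 V)%N.
Proof. by have := sum_pred_mult_le n alpha V; rewrite F1E -/mu -/D; lia. Qed.

(** Markov's inequality for [2 ^ m * X], whose mean is [F1]. *)
Lemma card_overflow : (6 * #|[set s | (6 * F1 < 2 ^ m * X s)%N]| <= #|{ffun 'I_sb -> bool}|)%N.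
Proof.
have := sum_sampled _ _ (fun s j => m <= lev s j)%N (2 ^ m) (fun j => lev1 j m m_le) mu.
rewrite -/F1 => E.
have F1_gt0 : (0 < F1)%N by rewrite F1E addn_gt0 F0_gt0.
rewrite -(leq_pmul2r F1_gt0) -E mulnAC mulnC -sum_nat_cond_const.
rewrite [X in (X <= _)%N]big_mkcond /=; apply: leq_sum => s _; case: ifP => // H.
by move: H; rewrite ?inE [leqRHS]mulnC => /ltnW.
Qed.

(** Chebyshev's inequality. At level zero everything is sampled and the error vanishes; otherwise
    [exp_level_le] bounds the variance. *)
Lemma card_far : (6 * #|[set s | (eps * (F0 V)%:R < `|2 ^+ m * (Z s)%:R - D%:R|)%R]|
   <= #|{ffun 'I_sb -> bool}|)%N.
Proof.
case: (posnP m) => [m0|m_gt0].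
  rewrite (_ : [set s | _] = set0) ?cards0 //; apply/setP=> s; rewrite !inE.
  have -> : Z s = D by apply: eq_bigr => j _; rewrite m0 mul1n.
  by rewrite m0 mul1r subrr normr0 lt_gtF // mulr_gt0 // ltr0n.
have E2 j k : j != k -> 
   (#|[set s | (m <= lev s j)%N && (m <= lev s k)%N]| * (2 ^ m) ^ 2 = #|{ffun 'I_sb -> bool}|)%N.
  by move=> jk; rewrite expnAC; apply: lev2.
have := sum_sampled_sqr R _ _ (fun s j => m <= lev s j)%N (2 ^ m) (fun j => lev1 j m m_le)
  E2 (fun j => (mu j).-1).
set B := [set s | _]; set N := #|{ffun 'I_sb -> bool}| => H.
set e2 := (eps * (F0 V)%:R) ^+ 2.
have e2_gt0 : 0 < e2 by rewrite exprn_gt0 // mulr_gt0 // ltr0n.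
have lower : #|B|%:R * e2 <= \sum_s (2 ^+ m * (Z s)%:R - D%:R) ^+ 2.
  rewrite mulr_natl -sumr_const big_mkcond /=; apply: ler_sum => s _.
  case: ifP; last by rewrite sqr_ge0.
  rewrite inE => /ltW far; rewrite -[leRHS]real_normK ?num_real //.
  by rewrite ler_sqr ?nnegrE // mulr_ge0 ?ler0n // ltW.
(* The variance is at most [2 ^ m * 2 * C <= eps ^ 2 * F1 ^ 2 / 54], and [F1 <= 3 * F0] turns
   [9 / 54] into [1 / 6]. *)
have upper : (2 ^ m)%:R * (\sum_j (mu j).-1 ^ 2)%:R <= e2 / 6.
  have S2 : (\sum_j (mu j).-1 ^ 2)%:R <= 2 * C%:R :> R.
    rewrite -natrM ler_nat; apply: leq_trans (sum_sqr_pred_mult n alpha V) _.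
    by rewrite leq_mul2l coll_le.
  apply: le_trans (ler_wpM2l (ler0n _ _) S2) _.
  have := exp_level_le R C eps F1 m_gt0; rewrite -/m natrX.
  rewrite ler_pdivlMr ?mulr_gt0 ?ltr0n // => lex.
  have : F1%:R ^+ 2 <= (3 * (F0 V)%:R) ^+ 2 :> R.
    by rewrite ler_sqr ?nnegrE ?mulr_ge0 ?ler0n // -natrM ler_nat.
  rewrite /e2 exprMn => F1q; have := ler_wpM2l (sqr_ge0 eps) F1q; rewrite exprMn.
  nra.
have: #|B|%:R * e2 <= N%:R * (e2 / 6).
  apply: le_trans lower _.
  apply: le_trans (_ : _ <= N%:R * ((2 ^ m)%:R * (\sum_j (mu j).-1 ^ 2)%:R)) _.
    rewrite mulrA natrX; rewrite natrX in H. exact: H.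
  by rewrite ler_wpM2l // ler0n.
by rewrite -(ler_nat R) natrM -(ler_pM2r e2_gt0); lra.
Qed.

(** Union bound: two failure events of probability at most [1 / 6] each. *)
Lemma card_good : (2 * #|{ffun 'I_sb -> bool}| <=
  3 * #|[set s | (2 ^ m * X s <= 6 * F1)%N &&
     (`|2 ^+ m * (Z s)%:R - D%:R| <= eps * (F0 V)%:R)%R]|)%N.
Proof.
set G := [set s | _].
set B1 := [set s | (6 * F1 < 2 ^ m * X s)%N].
set B2 := [set s | (eps * (F0 V)%:R < `|2 ^+ m * (Z s)%:R - D%:R|)%R].
have := card_overflow; have := card_far; rewrite -/B1 -/B2.
have : (#|~: G| <= #|B1| + #|B2|)%N.
  apply: leq_trans (leq_card_setU _ _); apply: subset_leq_card; apply/subsetP => s.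
  by rewrite !inE negb_and -ltnNge -ltNge.
have : (#|G| + #|~: G| = #|{ffun 'I_sb -> bool}|)%N := cardsC G.
move: #|_| #|_| #|_| #|_| #|_| => *; lia.
Qed.
End Success.

Lemma approx_dist (R : realType) (eps F Fh : R) :
  `|F - Fh| <= eps * F -> approx eps F Fh.
Proof. by rewrite ler_norml => /andP[lo hi]; split; lra. Qed.

(** Since [2 ^ m.+1] exceeds [eps ^ 2 * F1 ^ 2 / (108 * C)], the cutoff gives
    [X <= 6 * 216 * C / (eps ^ 2 * F1)], and [6 * 216 = 1296]. The maximum is at least its entry
    [F^-1]. *)
Lemma size_sampled_le (R : realType) (C : nat) (eps : R) (F1 X F : nat) :
  0 < eps -> (0 < F)%N -> (F <= F1)%N -> go R C eps F1 X ->
  X%:R <= 1296 * (Num.max F%:R^-1 (eps ^+ 2) * C%:R / eps ^+ 2).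
Proof.
move=> e0 F_gt0 FF1 /andP[C_gt0 mX].
set m := level R C eps F1 in mX.
have xm := exp_level_gt R C eps F1; rewrite -/m (exprS 2 m) in xm.
have e2 : 0 < eps ^+ 2 by rewrite exprn_gt0.
have F0r : 0 < F%:R :> R by rewrite ltr0n.
have F1r : F%:R <= F1%:R :> R by rewrite ler_nat.
have F1p : 0 < F1%:R :> R by apply: lt_le_trans F1r.
have C0 : 0 < C%:R :> R by rewrite ltr0n.
have {}mX : 2 ^+ m * X%:R <= 6 * F1%:R :> R by rewrite -natrX -!natrM ler_nat.
rewrite ltr_pdivrMr ?mulr_gt0 ?ltr0n // in xm.
apply: le_trans (_ : 1296 * (F%:R^-1 * C%:R / eps ^+ 2) <= _); last first.
  by rewrite ler_pM2l // ler_pM2r ?invr_gt0 // ler_pM2r // le_max lexx.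
have -> : 1296 * (F%:R^-1 * C%:R / eps ^+ 2) = 1296 * C%:R / (eps ^+ 2 * F%:R) :> R.
  by field; rewrite !gt_eqF.
rewrite ler_pdivlMr ?mulr_gt0 //.
have X0 := ler0n R X.
apply: le_trans (_ : X%:R * (eps ^+ 2 * F1%:R) <= _); first by rewrite ler_wpM2l // ler_pM2l.
rewrite -(ler_pM2r F1p).
have H1 := ler_wpM2r X0 (ltW xm).
have H2 : 216 * C%:R * (2 ^+ m * X%:R) <= 216 * C%:R * (6 * F1%:R) :> R.
  by rewrite ler_wpM2l // mulr_ge0 // ltW.
lra.
Qed.

Theorem theorem1p2 (R : realType) :
  exists (K c : nat),
  forall (n alpha : nat) (eps : R) (C : nat),
    (0 < n)%N -> (0 < alpha)%N -> 0 < eps -> eps < 1 ->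
    exists P : protocol R n alpha,
      forall V : dataset n alpha,
        (collisions V <= C)%N -> (C <= F0 V)%N ->
        let L := ((lg n + lg alpha + lgR eps^-1)%N)%:R : R in
        (cost P V)%:R <=
          K%:R * (alpha%:R * (lg n)%:R
                  + Num.max ((F0 V)%:R^-1) (eps ^+ 2) * C%:R / eps ^+ 2
                    * (lg n)%:R) * L ^+ c
        /\ succeeds_whp P (fun Fh => approx eps (F0 V)%:R Fh) V.
Proof.
exists 1296%N, 1%N => n alpha eps C n_gt0 alpha_gt0 eps_gt0 eps_lt1.
set M := (2 * lg n)%N.
have [lev [lev1 lev2]] := pairwise_levels n M.
pose c : 'I_alpha := Ordinal alpha_gt0.
exists (estimator R n alpha (M * lg n) M C eps c lev) => V coll_le C_le L.
pose F1 := (\sum_j mult V j)%N.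
pose D := (\sum_j (mult V j).-1)%N.
have F1E : F1 = (F0 V + D)%N := sum_mult_F0 n alpha V.
have D_le : (D <= 2 * C)%N.
  by apply: leq_trans (sum_pred_mult_le n alpha V) _; rewrite leq_mul2l.
have F0_le : (F0 V <= n)%N by rewrite -[n in (_ <= n)%N]card_ord max_card.
have m_le : (level R C eps F1 <= M)%N.
  have [C0|C_gt0] := posnP C.
    (* Division by zero yields zero, so the level is zero when [C = 0]. *)
    by rewrite /level C0 mulr0 invr0 mulr0 truncn0.
  by apply: (level_le R C eps F1 C_gt0 n) => //; lia.
have run r := estimator_run R n alpha (M * lg n) M C eps c lev V r m_le.
split.
  rewrite expr1 /cost.
  have lgL : (lg n)%:R <= L by rewrite ler_nat -addnA leq_addr.
  have lg1 : 1 <= (lg n)%:R :> R by rewrite ler1n.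
  have L1 : 1 <= L := le_trans lg1 lgL.
  have L0 : 0 <= L := le_trans ler01 L1.
  have a0 : 0 <= alpha%:R :> R by rewrite ler0n.
  set B := Num.max _ _ * C%:R / eps ^+ 2.
  have B0 : 0 <= B.
    by rewrite /B !mulr_ge0 ?invr_ge0 ?sqr_ge0 ?ler0n // le_max sqr_ge0 orbT.
  have alg0 : 0 <= alpha%:R * (lg n)%:R :> R by rewrite mulr_ge0.
  have Blg0 : 0 <= B * (lg n)%:R by rewrite mulr_ge0 // ler0n.
  (* The cost is a maximum over seeds, so it suffices to bound each single run. *)
  elim/big_ind: _ => [|x y Hx Hy|r _].
  - by rewrite !mulr_ge0 ?addr_ge0.
  - by rewrite /maxn; case: ifP.
  have [_ ->] := run r; rewrite -/F1.
  (* Per server, the seed and the counts take [2 * lg n ^ 2 + lg n * (2 * lg n + 1) <= 5 * lg n ^ 2]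
     bits; one factor [lg n] is absorbed in [L]. *)
  apply: le_trans (_ : 5 * (alpha%:R * (lg n)%:R) * L + 1296 * (B * (lg n)%:R) * L <= _); last first.
    have := mulr_ge0 alg0 L0; lra.
  rewrite natrD lerD //.
    apply: le_trans (_ : 5 * (alpha%:R * (lg n)%:R) * (lg n)%:R <= _); last first.
      by rewrite ler_wpM2l // mulr_ge0.
    by rewrite -!natrM ler_nat /M; have : (0 < lg n)%N by []; nia.
  case: ifP => [go_r|_]; last by rewrite mulr0n mulr_ge0 // mulr_ge0.
  apply: le_trans (_ : 1296 * (B * (lg n)%:R) <= _); last first.
    by rewrite ler_peMr // mulr_ge0.
  rewrite natrM mulrC mulrA ler_pM2r ?(lt_le_trans ltr01 lg1) //.
  case/andP: (go_r) => C_gt0 _.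
  apply: (size_sampled_le R C eps F1 _ (F0 V)) => //; last by rewrite F1E leq_addr.
  exact: leq_trans C_gt0 C_le.
(* Without collisions [D = 0], and the fallback answer [F1] equals [F0] on every seed. *)
have [C_eq0|C_pos] := posnP C.
  exists setT; split=> [r _|]; last first.
    by rewrite ler_piMl ?ler0n // ler_pdivrMr // mul1r ler_nat.
  have [-> _] := run r; rewrite /go C_eq0 /= -/F1.
  have -> : F1 = F0 V by lia.
  by apply: approx_dist; rewrite subrr normr0 mulr_ge0 ?ler0n // ltW.
pose G := [set s : seed (M * lg n) | go R C eps F1
   (\sum_j (level R C eps F1 <= lev s j) * mult V j)%N &&
   (`|2 ^+ level R C eps F1 * (\sum_j (level R C eps F1 <= lev s j) * (mult V j).-1)%N%:R
      - D%:R| <= eps * (F0 V)%:R)%R].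
(* The output depends on the joint seed only through the coordinator's broadcast seed [r c]. *)
exists [set r : {ffun 'I_alpha -> seed (M * lg n)} | r c \in G]; split=> [r|].
  rewrite !inE => /andP[go_r close_r].
  have [-> _] := run r; rewrite /= -/F1 go_r; apply: approx_dist.
  move: close_r; rewrite F1E natrD.
  (* As [F1 = F0 + D], the error of the output is exactly the error of [z] as an estimate of [D]. *)
  by set z := _ * _ => close_r; rewrite (_ : _ - _ = z - D%:R) //; ring.
have good := card_good R n alpha (M * lg n) M C eps lev lev1 lev2 V coll_le C_le C_pos eps_gt0 m_le.
rewrite -/F1 -/D in good.
have {}good : (2 * #|{ffun 'I_(M * lg n) -> bool}| <= 3 * #|G|)%N.
  apply: leq_trans good _; rewrite leq_mul2l; apply/orP; right.
  by apply: subset_leq_card; apply/subsetP => s; rewrite !inE /go C_pos.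
have cE := card_coordinate 'I_alpha (seed (M * lg n)) c G.
rewrite mulrAC ler_pdivrMr ?ltr0n // -!natrM ler_nat cardsT [leqRHS]mulnC.
have t_gt0 : (0 < #|{ffun 'I_(M * lg n) -> bool}|)%N.
  by rewrite card_ffun expn_gt0 card_bool.
rewrite -(leq_pmul2r t_gt0).
apply: leq_trans (_ : _ <= 3 * (#|G| * #|{ffun 'I_alpha -> seed (M * lg n)}|))%N _.
  by rewrite mulnAC mulnA leq_mul2r good orbT.
by rewrite -[leqRHS]mulnA leq_mul2l; apply/orP; right; apply: eq_leq; symmetry; exact: cE.
Qed.
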